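(* Let $H$ be a definite Hamiltonian on $(a,b)$ in the limit circle case. Further, let $c>0$, set $r_0 := \bigl(\frac{c}{\det\Omega(a,b)}\bigr)^{\frac 12}$, let $(\hat t,\hat s)$ be the unique compatible pair for $H,r_0$ with constants $c,c$, let $K_H(t;r)$ be the corresponding kernel and $\kappa_H(r)$ be produced by the algorithm below. Then \[ \log 2\cdot\kappa_H(r)-\bigl(\log r+O(1)\bigr) \le \int_a^b K_H(t;r)\,\mathrm{d}t \le 2e\cdot\kappa_H(r)\bigl(\log r+O(1)\bigr) \] for $r>r_0$. The expressions $O(1)$ depend only on $c$ and $\operatorname{tr}\Omega(a,b)$; explicitly, \[ \int_a^b K_H(t;r)\,\mathrm{d}t\ge \kappa_H(r)\log 2-\Bigl[\log r+\log\frac{2\operatorname{tr}\Omega(a,b)}{\sqrt c}\Bigr],\qquad \int_a^b K_H(t;r)\,\mathrm{d}t\le 2e\kappa_H(r)\Bigl[\log r+\log\frac{\operatorname{tr}\Omega(a,b)}{2\sqrt c}+1\Bigr]. \]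
   Context: Let $-\infty<a<b\le\infty$. A Hamiltonian on $(a,b)$ is a measurable $H:(a,b)\to\mathbb{R}^{2\times 2}$, locally integrable on $(a,c)$ for $c<b$, with $H(t)\ge0$ a.e. and $\{H=0\}$ null; $H=\begin{pmatrix}h_1&h_3\\ h_3&h_2\end{pmatrix}$. It is in the limit circle case if $\int_a^b\operatorname{tr}H<\infty$, and definite if there is no $\phi$ with $H(t)=\operatorname{tr}H(t)\,\xi_\phi\xi_\phi^T$ a.e. on $(a,b)$, $\xi_\phi=(\cos\phi,\sin\phi)^T$. Set $\Omega(s,t)=\int_s^tH(u)\,\mathrm{d}u$, $\omega_j(s,t)=\int_s^th_j$. The (unique) compatible pair $(\hat t,\hat s)$ for $H,r_0$ with constants $c,c$ is given by $\det\Omega(a,\hat t(r))=\frac{c}{r^2}$ for $r>r_0$ and $\det\Omega(\hat s(t;r),t)=\frac{c}{r^2}$, $\hat s(t;r)\le t$, for $t\ge\hat t(r)$. Kernel: $K_H(t;r):=\mathbf{1}_{[a,\hat t(r))}(t)\frac{\omega_2(a,t)h_1(t)}{\frac{c}{r^2}+(\omega_3(a,t))^2}+\mathbf{1}_{[\hat t(r),b)}(t)\frac{h_1(t)}{\omega_1(\hat s(t;r),t)}$. Algorithm: for $r>0$ set $\sigma_0^{(r)}:=a$; if $\det\Omega(\sigma_{j-1}^{(r)},b)>\frac{c}{r^2}$, let $\sigma_j^{(r)}\in(\sigma_{j-1}^{(r)},b)$ be the unique point with $\det\Omega(\sigma_{j-1}^{(r)},\sigma_j^{(r)})=\frac{c}{r^2}$;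 otherwise set $\sigma_j^{(r)}:=b$ and $\kappa_H(r):=j$ and stop. *)

(* Defs.v *)
From HB Require Import structures.
From mathcomp Require Import all_boot all_order all_algebra.
From mathcomp Require Import all_classical all_reals all_analysis.
Set Implicit Arguments. Unset Strict Implicit. Unset Printing Implicit Defensive.
Import Order.TTheory GRing.Theory Num.Theory.
Import numFieldNormedType.Exports.
Local Open Scope classical_set_scope.
Local Open Scope ring_scope.

Section Hamiltonian.
Variable R : realType.
Local Notation mu := (@lebesgue_measure R).

Definition Iv (s : R) (t : \bar R) : set R :=
  [set x : R | s < x /\ (x%:E < t)%E].

Definition omega (h : R -> R) (s : R) (t : \bar R) : R := Rintegral mu (Iv s t) h.

(* det Omega(s,t) for H = [[h1,h3],[h3,h2]] *)
Definition detOm (h1 h2 h3 : R -> R) (s : R) (t : \bar R) : R :=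
  omega h1 s t * omega h2 s t - omega h3 s t ^+ 2.

Definition trOm (h1 h2 : R -> R) (s : R) (t : \bar R) : R :=
  omega h1 s t + omega h2 s t.

Definition hamiltonian (a : R) (b : \bar R) (h1 h2 h3 : R -> R) : Prop :=
  [/\ (a%:E < b)%E,
      (forall c : R, (c%:E < b)%E ->
         [/\ mu.-integrable (Iv a c%:E) (EFin \o h1),
             mu.-integrable (Iv a c%:E) (EFin \o h2) &
             mu.-integrable (Iv a c%:E) (EFin \o h3)]),
      mu.-negligible [set x | Iv a b x /\
         ~ (forall u v : R, 0 <= h1 x * u ^+ 2 + 2 * h3 x * u * v + h2 x * v ^+ 2)] &
      mu.-negligible [set x | Iv a b x /\ h1 x = 0 /\ h2 x = 0 /\ h3 x = 0]].

Definition limit_circle (a : R) (b : \bar R) (h1 h2 : R -> R) : Prop :=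
  (\int[mu]_(x in Iv a b) (h1 x + h2 x)%:E < +oo)%E.

(* definite: no phi with H = tr H * xi_phi xi_phi^T a.e. on (a,b) *)
Definition definite (a : R) (b : \bar R) (h1 h2 h3 : R -> R) : Prop :=
  ~ exists phi : R,
      mu.-negligible [set x | Iv a b x /\
        ~ [/\ h1 x = (h1 x + h2 x) * (cos phi) ^+ 2,
              h2 x = (h1 x + h2 x) * (sin phi) ^+ 2 &
              h3 x = (h1 x + h2 x) * (cos phi * sin phi)]].

Definition compatible_pair (a : R) (b : \bar R) (h1 h2 h3 : R -> R) (r0 c : R)
    (tt : R -> R) (ss : R -> R -> R) : Prop :=
  (forall r, r0 < r ->
     [/\ a < tt r, ((tt r)%:E < b)%E & detOm h1 h2 h3 a (tt r)%:E = c / r ^+ 2]) /\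
  (forall r t, r0 < r -> tt r <= t -> (t%:E < b)%E ->
     [/\ a <= ss t r, ss t r <= t & detOm h1 h2 h3 (ss t r) t%:E = c / r ^+ 2]).

Definition kernelH (a : R) (h1 h2 h3 : R -> R) (c : R)
    (tt : R -> R) (ss : R -> R -> R) (r t : R) : R :=
  if t < tt r then
    omega h2 a t%:E * h1 t / (c / r ^+ 2 + (omega h3 a t%:E) ^+ 2)
  else h1 t / omega h1 (ss t r) t%:E.

(* kappa_H(r) = k : the algorithm sigma_0 = a, sigma_j (j < k) real points with
   det Omega(sigma_{j-1}, b) > c/r^2 and det Omega(sigma_{j-1}, sigma_j) = c/r^2,
   and it stops at step k because det Omega(sigma_{k-1}, b) <= c/r^2
   (then sigma_k := b and kappa_H(r) := k). *)
Definition kappa_is (a : R) (b : \bar R) (h1 h2 h3 : R -> R) (c r : R) (k : nat) : Prop :=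
  (0 < k)%N /\
  exists sigma : nat -> R,
    [/\ sigma 0%N = a,
        (forall j : nat, (j.+1 < k)%N ->
           [/\ c / r ^+ 2 < detOm h1 h2 h3 (sigma j) b,
               sigma j < sigma j.+1, ((sigma j.+1)%:E < b)%E &
               detOm h1 h2 h3 (sigma j) (sigma j.+1)%:E = c / r ^+ 2]) &
        detOm h1 h2 h3 (sigma k.-1) b <= c / r ^+ 2].

End Hamiltonian.

(* Main.v *)
Require Import Defs.
From HB Require Import structures.
From mathcomp Require Import all_boot all_order all_algebra.
From mathcomp Require Import all_classical all_reals all_analysis.
From mathcomp Require Import measurable_realfun ring lra.
Import Order.TTheory GRing.Theory Num.Theory.
Import numFieldNormedType.Exports.
Local Open Scope classical_set_scope.
Local Open Scope ring_scope.

(** Write [eps = c / r^2] and let [sigma_0 = a < sigma_1 < ...] be the points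
    produced by the algorithm. On a step [(sigma_j, sigma_{j+1})] with [j >= 1] one
    has [sigma_{j-1} <= s(t) <= sigma_j], because [det Omega] is strictly monotone
    under enlarging the interval, so the kernel lies between
    [h1 / omega1(sigma_{j-1}, t)] and [h1 / omega1(sigma_j, t)]. The latter bound also
    holds on the first step, as [det Omega(a, t) <= eps] there. Moreover the kernel is
    everywhere at most [h1 * M] with [M = omega2(a, b) / eps].

    Upper bound: integrating [min (h1 / omega1(sigma_j, t), h1 * M)] costs at most
    [1 + (e - 1) * n] as soon as [M * omega1(a, b) <= e^n], by cutting the step where
    [omega1(sigma_j, t) = e^i / M].

    Lower bound: with [x_j = omega1(sigma_j, sigma_{j+1})], step [j + 1] contributes at
    least [ln (1 + x_{j+1} / x_j) >= ln 2 + (ln x_{j+1} - ln x_j) / 2]; the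
    differences telescope.

    The error terms come from [4 * omega1(a, b) * omega2(a, b) <= (tr Omega(a, b))^2]. *)

(** * Integrals over open intervals: additivity, monotonicity, continuity, intermediate values *)

Section Intervals.
Context {R : realType}.
Notation mu := (@lebesgue_measure R).
Implicit Types (f g K : R -> R) (u w x y z : R) (v b : \bar R).

Lemma measurable_Iv u v : measurable (Iv u v).
Proof.
apply: is_interval_measurable => x y [/= ux xv] [uy yv] z /andP[xz zy].
by split; [exact: lt_le_trans ux xz | apply: le_lt_trans yv; rewrite lee_fin].
Qed.
#[local] Hint Extern 0 (_.-measurable (Iv _ _)) => solve [exact: measurable_Iv] : core.

Lemma subset_Iv u w v b : u <= w -> (v <= b)%E -> Iv w v `<=` Iv u b.
Proof.
by move=> uw vb x [/= wx xv]; split; [exact: le_lt_trans wx | exact: lt_le_trans vb].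
Qed.

(** Deleting [w] from [Iv w v] changes nothing; it is written so that both sides have the form left
    when the null point [w] is removed from a domain of integration. *)
Lemma Iv_set1C u w v : u <= w -> (w%:E <= v)%E ->
  Iv u v `\ w = Iv u w%:E `|` (Iv w v `\ w).
Proof.
move=> uw wv; apply/seteqP; split => x /=.
- move=> [[ux xv] /eqP]; rewrite neq_lt => /orP[xw|wx].
  + by left; split; rewrite ?lte_fin.
  + by right; split => //; apply/eqP; rewrite gt_eqF.
- case => [[ux xw]|[[wx xv] xw]]; split => //.
  + by split => //; exact: lt_le_trans wv.
  + by apply/eqP; rewrite lt_eqF.
  + by split => //; exact: le_lt_trans wx.
Qed.

Lemma Iv_disjoint u w v : [disjoint Iv u w%:E & Iv w v `\ w].
Proof.
apply/disj_setPS => x [[/= _ xw] [[wx _] _]].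
by move: xw; rewrite lte_fin ltNge (ltW wx).
Qed.

(** For nonnegative extended-real integrands, so that it applies to the kernel before its integral
    is known to be finite. *)
Lemma ge0_integral_Iv_cat u w v (K : R -> \bar R) : u <= w -> (w%:E <= v)%E ->
  measurable_fun (Iv u v) K -> (forall x, Iv u v x -> (0 <= K x)%E) ->
  (\int[mu]_(x in Iv u v) K x =
   \int[mu]_(x in Iv u w%:E) K x + \int[mu]_(x in Iv w v) K x)%E.
Proof.
move=> uw wv mK K0.
have suv : Iv w v `<=` Iv u v by exact: subset_Iv.
have mw : measurable [set w] by exact: measurable_set1.
have w0 : mu [set w] = 0%E by exact: lebesgue_measure_set1.
have rm A : measurable A -> A `<=` Iv u v ->
    (\int[mu]_(x in A) K x = \int[mu]_(x in A `\ w) K x)%E.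
  move=> mA Auv; apply: ge0_negligible_integral => //.
  - exact: measurable_funS mK.
  - by move=> x /Auv; exact: K0.
rewrite (rm (Iv u v))// (rm (Iv w v))//.
rewrite Iv_set1C// ge0_integral_setU//.
- exact: measurableD.
- by rewrite -Iv_set1C//; apply: measurable_funS mK => //; exact: subDsetl.
- by move=> x; rewrite -Iv_set1C// => -[+ _]; exact: K0.
- exact: Iv_disjoint.
Qed.

Lemma omega_cat u w v f : mu.-integrable setT (EFin \o f) ->
  u <= w -> (w%:E <= v)%E -> omega f u v = omega f u w%:E + omega f w v.
Proof.
move=> fi uw wv; rewrite /omega.
have mw : measurable [set w] by exact: measurable_set1.
have w0 : mu [set w] = 0%E by exact: lebesgue_measure_set1.
have fiS A : measurable A -> mu.-integrable A (EFin \o f).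
  by move=> mA; exact: integrableS fi.
have rm s t : \int[mu]_(x in Iv s t) f x = \int[mu]_(x in Iv s t `\ w) f x.
  by congr fine; apply: negligible_integral => //; exact: fiS.
rewrite (rm u v) (rm w v) Iv_set1C// Rintegral_setU//.
- exact: measurableD.
- by apply: fiS; apply: measurableU => //; exact: measurableD.
- exact: Iv_disjoint.
Qed.

Lemma omega_ge0 f u v : (forall x, 0 <= f x) -> 0 <= omega f u v.
Proof. by move=> f0; exact: Rintegral_ge0. Qed.

Lemma le_omega f u w v b : mu.-integrable setT (EFin \o f) ->
  (forall x, 0 <= f x) -> u <= w -> (w%:E <= v)%E -> (v <= b)%E ->
  omega f w v <= omega f u b.
Proof.
move=> fi f0 uw wv vb; rewrite /omega /Rintegral.
have fiS s t : mu.-integrable (Iv s t) (EFin \o f) by exact: integrableS fi.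
have fin s t : (\int[mu]_(x in Iv s t) (f x)%:E)%E \is a fin_num.
  exact: integrable_fin_num (fiS s t).
rewrite fine_le//; apply: ge0_subset_integral => //.
- exact: measurable_int (fiS u b).
- by move=> x _; rewrite lee_fin.
- exact: subset_Iv.
Qed.

Lemma EFin_omega f u v : mu.-integrable setT (EFin \o f) ->
  (omega f u v)%:E = (\int[mu]_(x in Iv u v) (f x)%:E)%E.
Proof.
move=> fi; rewrite /omega /Rintegral fineK//.
by apply: integrable_fin_num => //; exact: integrableS fi.
Qed.

Lemma omegaD f g u v : mu.-integrable setT (EFin \o f) ->
  mu.-integrable setT (EFin \o g) ->
  omega (fun x => f x + g x) u v = omega f u v + omega g u v.
Proof.
by move=> fi gi; rewrite /omega RintegralD//; [exact: integrableS fi|exact: integrableS gi].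
Qed.

Lemma omegaZl f k u v : mu.-integrable setT (EFin \o f) ->
  omega (fun x => k * f x) u v = k * omega f u v.
Proof. by move=> fi; rewrite /omega RintegralZl//; exact: integrableS fi. Qed.

(** Absolute continuity of the integral. The increment is taken over a difference set, which lies in
    [[x, y]] whatever the position of [a]. *)
Lemma omega_continuous f a : mu.-integrable setT (EFin \o f) ->
  continuous (fun x : R => omega f a x%:E).
Proof.
move=> fi; have fiS A : measurable A -> mu.-integrable A (EFin \o f).
  by move=> mA; exact: integrableS fi.
suff step (e : R) : 0 < e -> exists2 d, 0 < d & forall x y, x <= y -> y - x < d ->
    `|omega f a x%:E - omega f a y%:E| < e.
  move=> x; apply/cvgrPdist_lt => e /step[d d0 H].
  near=> y.
  have yd : `|x - y| < d by near: y; exact: cvgr_dist_lt.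
  case: (leP x y) => [xy|/ltW yx].
    by apply: H => //; rewrite -(ger0_norm (_ : 0 <= y - x)) ?subr_ge0// distrC.
  by rewrite distrC; apply: H => //; rewrite -(ger0_norm (_ : 0 <= x - y)) ?subr_ge0.
move=> e0; have [d [d0 H]] := integral_normr_continuous fi e0.
exists d => // x y xy yxd.
have sxy : Iv a x%:E `<=` Iv a y%:E by apply: subset_Iv => //; rewrite lee_fin.
have mD : measurable (Iv a y%:E `\` Iv a x%:E) by exact: measurableD.
have -> : omega f a y%:E = omega f a x%:E + \int[mu]_(z in Iv a y%:E `\` Iv a x%:E) f z.
  rewrite /omega -Rintegral_setU//.
  - by rewrite setDUK.
  - by rewrite setDUK//; exact: fiS.
  - by rewrite disj_set2E setDIK.
rewrite opprD addNKr normrN.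
apply: (@le_lt_trans _ _ (\int[mu]_(z in Iv a y%:E `\` Iv a x%:E) `|f z|)).
  by apply: le_normr_Rintegral => //; exact: fiS.
apply: H => //; apply: (@le_lt_trans _ _ (mu `[x, y])).
  apply: le_measure; rewrite ?inE// => z [[/= az zy] nz].
  rewrite in_itv/=; move: zy; rewrite lte_fin => /ltW ->; rewrite andbT leNgt.
  by apply/negP => zx; apply: nz; split.
rewrite lebesgue_measure_itv/= lte_fin; by case: ifPn.
Unshelve. all: by end_near. Qed.

Lemma bigcup_Iv_nat u : \bigcup_n Iv u (n%:R)%:E = Iv u +oo%E.
Proof.
apply/seteqP; split => x /=.
  by move=> [n _ [ux xn]]; split => //; rewrite ltry.
move=> [ux _]; exists (Num.truncn x).+1 => //; split => //.
by rewrite lte_fin; exact: truncnS_gt.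
Qed.

Lemma omega_eq0 f u v : (v <= u%:E)%E -> omega f u v = 0.
Proof.
move=> vu; rewrite /omega (_ : Iv u v = set0) ?Rintegral_set0//.
apply/seteqP; split => x //= [ux xv].
by have := lt_le_trans xv vu; rewrite lte_fin => /(lt_trans ux); rewrite ltxx.
Qed.

Lemma omega_IVT f u v y : mu.-integrable setT (EFin \o f) ->
  (forall x, 0 <= f x) -> 0 <= y < omega f u v ->
  exists2 w, u <= w & (w%:E < v)%E /\ omega f u w%:E = y.
Proof.
move=> fi f0 /andP[y0 yv].
have uv : (u%:E < v)%E.
  by rewrite ltNge; apply/negP => /(omega_eq0 f) E; move: yv; rewrite E ltNge y0.
suff [z uz [zv yz]] : exists2 z, u <= z & (z%:E <= v)%E /\ y <= omega f u z%:E.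
  have omu : omega f u u%:E = 0 by exact: omega_eq0.
  have Hmm : Num.min (omega f u u%:E) (omega f u z%:E) <= y <=
      Num.max (omega f u u%:E) (omega f u z%:E).
    by rewrite omu ge_min le_max y0 yz orbT.
  have [w] := IVT uz (continuous_subspaceT (omega_continuous f u fi)) Hmm.
  rewrite in_itv/= => /andP[uw wz] wy; exists w => //; split => //.
  rewrite lt_neqAle (le_trans _ zv) ?lee_fin// andbT.
  by apply/eqP => wv; move: yv; rewrite -wv wy ltxx.
case: v uv yv => [z|_ yv|//].
  by rewrite lte_fin => uz yz; exists z; [exact: ltW|split => //; exact: ltW].
(* Now [v] is [+oo]: if every finite endpoint gave less than [y], monotone convergence along the
   intervals [(u, n)] would give [omega f u +oo <= y]. *)
apply: contrapT => H.
have mono : nondecreasing_seq (fun n => Iv u (n%:R)%:E).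
  by move=> m n mn; apply/subsetPset/subset_Iv => //; rewrite lee_fin ler_nat.
have cv : (\int[mu]_(x in Iv u (n%:R)%:E) (f x)%:E @[n --> \oo] -->
    \int[mu]_(x in Iv u +oo) (f x)%:E)%E.
  rewrite -bigcup_Iv_nat; apply: ge0_nondecreasing_set_cvg_integral => //.
  - by move=> n; apply: (measurable_int mu); exact: integrableS fi.
  - by move=> n x _; rewrite lee_fin.
suff : omega f u +oo%E <= y by rewrite leNgt yv.
rewrite -lee_fin EFin_omega//.
rewrite -(cvg_lim _ cv)//; apply: lime_le; first by apply/cvg_ex; eexists; exact: cv.
near=> n; rewrite -EFin_omega// lee_fin leNgt; apply/negP => yn.
apply: H; exists n%:R; last by split; [rewrite leey|exact: ltW].
by near: n; exact: nbhs_infty_ger.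
Unshelve. all: by end_near. Qed.

End Intervals.
#[local] Hint Extern 0 (_.-measurable (Iv _ _)) => solve [exact: measurable_Iv] : core.

(** * Logarithmic integrals estimated by geometric subdivision *)

Section LogarithmicIntegrals.
Context {R : realType}.
Notation mu := (@lebesgue_measure R).
Implicit Types (f K : R -> R) (u w : R) (v : \bar R).

Lemma integral_le_omega f K u v k : mu.-integrable setT (EFin \o f) ->
  measurable_fun (Iv u v) K ->
  (forall x, Iv u v x -> 0 <= K x <= k * f x) ->
  (\int[mu]_(x in Iv u v) (K x)%:E <= (k * omega f u v)%:E)%E.
Proof.
move=> fi mK Kf.
have fi' : mu.-integrable setT (EFin \o (fun x => k * f x)).
  by apply: eq_integrable (integrableZl measurableT k fi) => // x _.
rewrite -omegaZl// EFin_omega//; apply: ge0_le_integral => //.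
- by move=> x /Kf/andP[]; rewrite lee_fin.
- exact/measurable_EFinP.
- by apply: (measurable_int mu); exact: integrableS fi'.
- by move=> x /Kf/andP[]; rewrite lee_fin.
Qed.

Lemma omega_le_integral f K u v k : mu.-integrable setT (EFin \o f) ->
  measurable_fun (Iv u v) K ->
  (forall x, Iv u v x -> 0 <= k * f x <= K x) ->
  ((k * omega f u v)%:E <= \int[mu]_(x in Iv u v) (K x)%:E)%E.
Proof.
move=> fi mK Kf.
have fi' : mu.-integrable setT (EFin \o (fun x => k * f x)).
  by apply: eq_integrable (integrableZl measurableT k fi) => // x _.
rewrite -omegaZl// EFin_omega//; apply: ge0_le_integral => //.
- by move=> x /Kf/andP[]; rewrite lee_fin.
- by apply: (measurable_int mu); exact: integrableS fi'.
- exact/measurable_EFinP.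
- by move=> x /Kf/andP[]; rewrite lee_fin.
Qed.

(** Bounds the integral of [dF / F], with [F] the primitive of [f], without a change of variables:
    where [M F] runs from [e^i] to [e^(i+1)], one has [K <= (M / e^i) f], and [f] has mass at most
    [(e - 1) e^i / M]. The part where [M F <= 1] costs at most 1. *)
Lemma integral_kernel_le f K u v M n : mu.-integrable setT (EFin \o f) ->
  (forall x, 0 <= f x) -> 0 < M ->
  measurable_fun (Iv u v) K -> (forall x, Iv u v x -> 0 <= K x) ->
  (forall x, Iv u v x -> K x <= M * f x) ->
  (forall x, Iv u v x -> K x * omega f u x%:E <= f x) ->
  M * omega f u v <= expR 1 ^+ n ->
  (\int[mu]_(x in Iv u v) (K x)%:E <= (1 + n%:R * (expR 1 - 1))%:E)%E.
Proof.
move=> fi f0 M0.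
have e1 : 1 < expR 1 :> R by rewrite expR_gt1.
elim: n v => [|n IHn] v mK K0 KM Kf Mv.
  rewrite mul0r addr0; apply: le_trans (integral_le_omega f K u v M fi mK _) _.
    by move=> x ux; rewrite K0// KM.
  by rewrite lee_fin -[leRHS](expr0 (expR 1)).
case: (leP (M * omega f u v) (expR 1 ^+ n)) => [Mn|nM].
  apply: le_trans (IHn v mK K0 KM Kf Mn) _.
  by rewrite lee_fin lerD2l ler_wpM2r ?ler_nat// subr_ge0 ltW.
have en0 : 0 < expR 1 ^+ n :> R by rewrite exprn_gt0// expR_gt0.
have yv : 0 <= expR 1 ^+ n / M < omega f u v.
  by rewrite divr_ge0 ?(ltW en0) ?(ltW M0)//= ltr_pdivrMr// mulrC.
have [w uw [wv Ew]] := omega_IVT f u v _ fi f0 yv.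
have s1 : Iv u w%:E `<=` Iv u v by apply: subset_Iv => //; exact: ltW.
have s2 : Iv w v `<=` Iv u v by exact: subset_Iv.
rewrite (@ge0_integral_Iv_cat _ u w)//; last first.
- exact/measurable_EFinP.
- exact: ltW.
have -> : 1 + n.+1%:R * (expR 1 - 1) = 1 + n%:R * (expR 1 - 1) + (expR 1 - 1) :> R.
  by rewrite -natr1 mulrDl mul1r addrA.
rewrite EFinD; apply: leeD.
  apply: IHn.
  - exact: measurable_funS mK.
  - by move=> x /s1; exact: K0.
  - by move=> x /s1; exact: KM.
  - by move=> x /s1; exact: Kf.
  - by rewrite Ew mulrC divfK// gt_eqF.
apply: le_trans (integral_le_omega f K w v (M / expR 1 ^+ n) fi _ _) _.
- exact: measurable_funS mK.
- move=> x wx; have ux := s2 _ wx; rewrite K0//=.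
  have := Kf _ ux; rewrite mulrAC ler_pdivlMr//.
  have : omega f u w%:E <= omega f u x%:E.
    by apply: le_omega => //; rewrite lee_fin// ltW//; case: wx.
  rewrite Ew ler_pdivrMr// => H1 H2.
  apply: (@le_trans _ _ (M * (K x * omega f u x%:E))); last by rewrite ler_pM2l.
  by rewrite mulrCA ler_wpM2l ?K0// mulrC.
rewrite lee_fin lerBrDr.
have -> : omega f w v = omega f u v - expR 1 ^+ n / M.
  by rewrite (@omega_cat _ u w v)// ?(ltW wv)// Ew addrC addKr.
have -> : M / expR 1 ^+ n * (omega f u v - expR 1 ^+ n / M) + 1 =
    M / expR 1 ^+ n * omega f u v by field; rewrite !gt_eqF.
by rewrite mulrAC ler_pdivrMr// -exprS.
Qed.

(** A lower Riemann sum: each piece multiplies [A + omega f u x] by at least [q], so its mass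
    divided by the value of [A + omega f u x] at its right end is at least [1 - q^-1]. *)
Lemma integral_kernel_ge f K u v A q n : mu.-integrable setT (EFin \o f) ->
  (forall x, 0 <= f x) -> 0 < A -> 1 < q ->
  measurable_fun (Iv u v) K -> (forall x, Iv u v x -> 0 <= K x) ->
  (forall x, Iv u v x -> f x <= K x * (A + omega f u x%:E)) ->
  A * q ^+ n <= A + omega f u v ->
  ((n%:R * (1 - q^-1))%:E <= \int[mu]_(x in Iv u v) (K x)%:E)%E.
Proof.
move=> fi f0 A0 q1.
have q0 : 0 < q by exact: lt_trans q1.
have o0 := fun a b => omega_ge0 f a b f0.
elim: n v => [|n IHn] v mK K0 Kf Av.
  by rewrite mul0r; apply: integral_ge0 => x /K0; rewrite lee_fin.
have yv : 0 <= A * q ^+ n - A < omega f u v.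
  rewrite subr_ge0 ler_peMr ?exprn_ege1 ?(ltW q1) ?(ltW A0)//= ltrBlDl.
  by apply: lt_le_trans Av; rewrite ltr_pM2l// exprS ltr_pMl// exprn_gt0.
have [w uw [wv Ew]] := omega_IVT f u v _ fi f0 yv.
have s1 : Iv u w%:E `<=` Iv u v by apply: subset_Iv => //; exact: ltW.
have s2 : Iv w v `<=` Iv u v by exact: subset_Iv.
rewrite (@ge0_integral_Iv_cat _ u w)//; last first.
- exact/measurable_EFinP.
- exact: ltW.
have -> : n.+1%:R * (1 - q^-1) = n%:R * (1 - q^-1) + (1 - q^-1) :> R.
  by rewrite -natr1 mulrDl mul1r.
rewrite EFinD; apply: leeD.
  apply: IHn.
  - exact: measurable_funS mK.
  - by move=> x /s1; exact: K0.
  - by move=> x /s1; exact: Kf.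
  - by rewrite Ew; lra.
have Av0 : 0 < A + omega f u v by rewrite ltr_wpDr.
apply: le_trans (omega_le_integral f K w v (A + omega f u v)^-1 fi _ _).
- rewrite lee_fin.
  have -> : omega f w v = (A + omega f u v) - A * q ^+ n.
    by rewrite (@omega_cat _ u w v)// ?(ltW wv)// Ew; lra.
  rewrite mulrBr mulVf ?gt_eqF// lerD2l lerN2 mulrC ler_pdivrMr//.
  by rewrite -ler_pdivrMl ?invr_gt0// invrK mulrC -mulrA -exprSr.
- exact: measurable_funS mK.
- move=> x wx; have ux := s2 _ wx.
  rewrite mulr_ge0 ?invr_ge0 ?(ltW Av0)//= mulrC ler_pdivrMr//.
  apply: le_trans (Kf _ ux) _; rewrite ler_wpM2l ?K0// lerD2l.
  by apply: le_omega => //; case: ux => // ? ?; [rewrite lee_fin ltW|exact: ltW].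
Qed.

Lemma integral_kernel_ge_ln f K u v A : mu.-integrable setT (EFin \o f) ->
  (forall x, 0 <= f x) -> 0 < A ->
  measurable_fun (Iv u v) K -> (forall x, Iv u v x -> 0 <= K x) ->
  (forall x, Iv u v x -> f x <= K x * (A + omega f u x%:E)) ->
  ((ln (1 + omega f u v / A))%:E <= \int[mu]_(x in Iv u v) (K x)%:E)%E.
Proof.
move=> fi f0 A0 mK K0 Kf.
set I := (\int[mu]_(x in _) _)%E; set L := ln _.
have I0 : (0 <= I)%E by apply: integral_ge0 => x /K0; rewrite lee_fin.
have oA : 0 <= omega f u v / A by rewrite divr_ge0 ?(omega_ge0 f)// ltW.
have [L0|L0] := leP L 0; first by apply: le_trans I0; rewrite lee_fin.
(* The ratio [q = exp(L / (n + 1))] makes [A q^(n + 1)] equal to [A + omega f u v], and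
   [exp x >= 1 + x] gives [1 - q^-1 >= L / (n + 1 + L)]. *)
have HI n : ((n.+1%:R * L / (n.+1%:R + L))%:E <= I)%E.
  have n0 : 0 < n.+1%:R :> R by [].
  have q1 : 1 < expR (L / n.+1%:R) by rewrite expR_gt1 divr_gt0.
  apply: le_trans (integral_kernel_ge f K u v A (expR (L / n.+1%:R)) n.+1
    fi f0 A0 q1 mK K0 Kf _); last first.
    rewrite -expRM_natl mulrCA divff ?pnatr_eq0// mulr1 lnK ?posrE ?ltr_wpDr//.
    by rewrite mulrDr mulr1 mulrCA divff ?mulr1 ?gt_eqF.
  rewrite lee_fin -mulrA ler_pM2l// lerBrDr -lerBrDl.
  have := @expR_ge1Dx R (L / n.+1%:R).
  have p0 : 0 < 1 + L / n.+1%:R by rewrite ltr_pwDl// divr_ge0// ltW.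
  rewrite -lef_pV2 ?posrE ?expR_gt0// => /le_trans; apply.
  rewrite le_eqVlt; apply/orP; left; apply/eqP; field.
  by rewrite !nat1r !gt_eqF// addr_gt0.
have : (I < +oo)%E \/ I = +oo%E.
  by case: I {HI} I0 => [x||]//; [left; rewrite ltry|right].
case => [Ioo|->]; last by rewrite leey.
have Ifin : I \is a fin_num by rewrite ge0_fin_numE.
move: HI; rewrite -(fineK Ifin) => HI; rewrite lee_fin.
have r0 : 0 <= fine I by exact: fine_ge0.
rewrite leNgt; apply/negP => rL.
(* The bound [m L / (m + L) <= I] fails as soon as [m > I L / (L - I)]. *)
pose x := fine I * L / (L - fine I).
have := HI (Num.truncn x); rewrite lee_fin.
have := truncnS_gt x; set m := _.+1%:R => xm.
have m0 : 0 < m by rewrite /m.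
rewrite ler_pdivrMr ?addr_gt0//.
move: xm; rewrite /x ltr_pdivrMr ?subr_gt0//; nra.
Qed.

End LogarithmicIntegrals.

(** * Positive semidefinite 2 by 2 matrices and superadditivity of the determinant *)

Section TwoByTwo.
Context {R : realType}.
Implicit Types p q z : R.

(** The form at [(- z, p)] or [(q, - z)] is a diagonal entry times the determinant; when both
    diagonal entries vanish, its value [- 2 z^2] at [(z, - 1)] forces [z = 0]. *)
Lemma psd2_det p q z : (forall x y, 0 <= p * x ^+ 2 + 2 * z * x * y + q * y ^+ 2) ->
  [/\ 0 <= p, 0 <= q & z ^+ 2 <= p * q].
Proof.
move=> H.
have p0 : 0 <= p by have := H 1 0; lra.
have q0 : 0 <= q by have := H 0 1; lra.
split => //.
have [pgt|] := ltP 0 p.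
  have := H (- z) p.
  have -> : p * (- z) ^+ 2 + 2 * z * (- z) * p + q * p ^+ 2 = p * (p * q - z ^+ 2) by ring.
  by rewrite pmulr_rge0// subr_ge0.
move=> ple; have {ple} pE : p = 0 by apply/eqP; rewrite eq_le ple.
have [qgt|] := ltP 0 q.
  have := H q (- z).
  have -> : p * q ^+ 2 + 2 * z * q * (- z) + q * (- z) ^+ 2 = q * (p * q - z ^+ 2) by ring.
  by rewrite pmulr_rge0// subr_ge0.
move=> qle; have {qle} qE : q = 0 by apply/eqP; rewrite eq_le qle.
by have := H z (- 1); rewrite pE qE; lra.
Qed.

Lemma det_psd2 p q z : 0 <= p -> 0 <= q -> z ^+ 2 <= p * q ->
  forall x y, 0 <= p * x ^+ 2 + 2 * z * x * y + q * y ^+ 2.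
Proof.
move=> p0 q0 zpq x y.
have [pgt|ple] := ltP 0 p.
  rewrite -(pmulr_rge0 _ pgt).
  have -> : p * (p * x ^+ 2 + 2 * z * x * y + q * y ^+ 2) =
    (p * x + z * y) ^+ 2 + (p * q - z ^+ 2) * y ^+ 2 by ring.
  by rewrite addr_ge0 ?sqr_ge0// mulr_ge0 ?sqr_ge0// subr_ge0.
have pE : p = 0 by apply/eqP; rewrite eq_le ple.
have zE : z = 0.
  by apply/eqP; rewrite -sqrf_eq0 eq_le sqr_ge0 andbT; move: zpq; rewrite pE mul0r.
by rewrite pE zE !(mul0r, mulr0) !add0r mulr_ge0 ?sqr_ge0.
Qed.

Variables a1 a2 a3 b1 b2 b3 : R.
Hypotheses (a10 : 0 <= a1) (a20 : 0 <= a2) (a312 : a3 ^+ 2 <= a1 * a2).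
Hypotheses (b10 : 0 <= b1) (b20 : 0 <= b2) (b312 : b3 ^+ 2 <= b1 * b2).

(** The difference of the two sides is the cross term of [det (A + B)]; AM-GM applies because
    [(a3 b3)^2 <= (a1 b2) (a2 b1)]. *)
Let mixed_ge0 : 2 * (a3 * b3) <= a1 * b2 + a2 * b1.
Proof.
rewrite leNgt; apply/negP => lt.
have S0 : 0 <= a1 * b2 + a2 * b1 by rewrite addr_ge0// mulr_ge0.
have : (a3 * b3) ^+ 2 <= (a1 * b2) * (a2 * b1).
  have -> : a1 * b2 * (a2 * b1) = (a1 * a2) * (b1 * b2) by ring.
  by rewrite exprMn ler_pM ?sqr_ge0.
have : (a1 * b2 + a2 * b1) ^+ 2 < (2 * (a3 * b3)) ^+ 2.
  by rewrite ltr_pXn2r// nnegrE (le_trans S0 (ltW lt)).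
have := sqr_ge0 (a1 * b2 - a2 * b1).
by set X := a1 * b2; set Y := a2 * b1; set Z := a3 * b3; nra.
Qed.

Lemma det_add_ge :
  b1 * b2 - b3 ^+ 2 <= (a1 + b1) * (a2 + b2) - (a3 + b3) ^+ 2.
Proof. by move: mixed_ge0 a312; lra. Qed.

Lemma det_add_gt : 0 < a1 + a2 -> b3 ^+ 2 < b1 * b2 ->
  b1 * b2 - b3 ^+ 2 < (a1 + b1) * (a2 + b2) - (a3 + b3) ^+ 2.
Proof.
move=> tr0 db.
have b12 : 0 < b1 * b2 by apply: le_lt_trans db; exact: sqr_ge0.
have b1p : 0 < b1.
  by rewrite lt_neqAle b10 andbT; apply/eqP => E; move: b12; rewrite -E mul0r ltxx.
have b2p : 0 < b2.
  by rewrite lt_neqAle b20 andbT; apply/eqP => E; move: b12; rewrite -E mulr0 ltxx.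
suff : 2 * (a3 * b3) < a1 * b2 + a2 * b1 by move: a312; lra.
(* Evaluating the form of [A] on the two columns of the adjugate of [B] and adding shows that [tr B]
   times the cross term is at least [tr A * det B > 0]. *)
have H1 : 0 <= b2 * (a1 * b2 + a2 * b1 - 2 * (a3 * b3)) - a2 * (b1 * b2 - b3 ^+ 2).
  by have := det_psd2 _ _ _ a10 a20 a312 b2 (- b3); congr (_ <= _); ring.
have H2 : 0 <= b1 * (a1 * b2 + a2 * b1 - 2 * (a3 * b3)) - a1 * (b1 * b2 - b3 ^+ 2).
  by have := det_psd2 _ _ _ a10 a20 a312 (- b3) b1; congr (_ <= _); ring.
have H3 : 0 < (a1 + a2) * (b1 * b2 - b3 ^+ 2) by rewrite mulr_gt0// subr_gt0.
rewrite -subr_gt0 -(pmulr_rgt0 _ (addr_gt0 b1p b2p)); lra.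
Qed.

End TwoByTwo.

(** * Determinants of integrals of a positive semidefinite density *)

Section PsdDensity.
Context {R : realType}.
Notation mu := (@lebesgue_measure R).
Variables (f1 f2 f3 : R -> R).
Hypotheses (fi1 : mu.-integrable setT (EFin \o f1))
  (fi2 : mu.-integrable setT (EFin \o f2)) (fi3 : mu.-integrable setT (EFin \o f3)).
Hypotheses (f10 : forall x, 0 <= f1 x) (f20 : forall x, 0 <= f2 x)
  (f312 : forall x, f3 x ^+ 2 <= f1 x * f2 x).

Lemma omega_CauchySchwarz u v : omega f3 u v ^+ 2 <= omega f1 u v * omega f2 u v.
Proof.
suff /psd2_det[] : forall x y, 0 <= omega f1 u v * x ^+ 2 +
  2 * omega f3 u v * x * y + omega f2 u v * y ^+ 2 by [].
move=> x y.
have iZ k (f : R -> R) : mu.-integrable setT (EFin \o f) ->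
    mu.-integrable setT (EFin \o (fun x => k * f x)).
  by move=> fi; apply: eq_integrable (integrableZl measurableT k fi).
have -> : omega f1 u v * x ^+ 2 + 2 * omega f3 u v * x * y + omega f2 u v * y ^+ 2 =
    omega (fun t => x ^+ 2 * f1 t + 2 * x * y * f3 t + y ^+ 2 * f2 t) u v.
  rewrite omegaD ?omegaD ?omegaZl//; try exact: iZ.
    by ring.
  by apply: eq_integrable (integrableD measurableT (iZ _ _ fi1) (iZ _ _ fi3)).
apply: omega_ge0 => t; have := det_psd2 _ _ _ (f10 t) (f20 t) (f312 t) x y.
by congr (_ <= _); ring.
Qed.

Notation D := (detOm f1 f2 f3).

(** Enlarging the interval adds a positive semidefinite matrix to [Omega]; the left end is moved
    first, then the right. *)
Lemma le_detOm u w v b : u <= w -> (w%:E <= v)%E -> (v <= b)%E ->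
  D w v <= D u b.
Proof.
move=> uw wv vb; apply: (@le_trans _ _ (D u v)).
  rewrite /detOm !(@omega_cat _ u w v)//.
  by apply: det_add_ge; rewrite ?omega_ge0//; exact: omega_CauchySchwarz.
have uv : (u%:E <= v)%E by apply: le_trans wv; rewrite lee_fin.
case: v vb uv {wv} => [v| |]; last by case: b.
- move=> vb uv; rewrite /detOm !(@omega_cat _ u v b)//.
  rewrite -!(addrC (omega _ v b)).
  by apply: det_add_ge; rewrite ?omega_ge0//; exact: omega_CauchySchwarz.
- by rewrite leye_eq => /eqP ->.
Qed.

(** Strictness in the left end locates [s t]; strictness in the right end, proved next, makes [T]
    the only solution of [det Omega(a, .) = eps]. *)
Lemma lt_detOm_left u w v : u <= w -> (w%:E <= v)%E -> 0 < trOm f1 f2 u w%:E ->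
  0 < D w v -> D w v < D u v.
Proof.
move=> uw wv tr0 D0; rewrite {2}/detOm !(@omega_cat _ u w v)//.
apply: det_add_gt; rewrite ?omega_ge0//; try exact: omega_CauchySchwarz.
by rewrite -subr_gt0.
Qed.

Lemma lt_detOm_right u w v : u <= w -> (w%:E <= v)%E -> 0 < trOm f1 f2 w v ->
  0 < D u w%:E -> D u w%:E < D u v.
Proof.
move=> uw wv tr0 D0; rewrite {2}/detOm !(@omega_cat _ u w v)//.
rewrite -!(addrC (omega _ w v)).
apply: det_add_gt; rewrite ?omega_ge0//; try exact: omega_CauchySchwarz.
by rewrite -subr_gt0.
Qed.

Lemma detOm_le_mul u v : D u v <= omega f1 u v * omega f2 u v.
Proof. by rewrite /detOm lerBlDr lerDl sqr_ge0. Qed.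

End PsdDensity.

(** * Measurability of monotone functions and of reciprocals *)

Section Measurability.
Context {R : realType}.

(** Superlevel sets of a monotone function on an interval are intervals. *)
Lemma nondecreasing_in_measurable (D : set R) (f : R -> R) : is_interval D ->
  (forall x y, D x -> D y -> x <= y -> f x <= f y) -> measurable_fun D f.
Proof.
move=> iD ndf; have mD : measurable D by exact: is_interval_measurable.
apply: (measurability (@RGenCInfty.G R)) => [|/= _ [_] [r] -> <-].
  exact: RGenCInfty.measurableE.
apply: is_interval_measurable => x y [/= Dx]; rewrite !in_itv/= !andbT => rx.
move=> [Dy _] z xzy; have Dz : D z by exact: iD xzy.
by split => //=; rewrite in_itv/= andbT (le_trans rx)// ndf//; case/andP: xzy.
Qed.

Lemma measurable_funV_gt0 (D : set R) (f : R -> R) : measurable D ->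
  measurable_fun D f -> (forall x, D x -> 0 < f x) ->
  measurable_fun D (fun x => (f x)^-1).
Proof.
move=> mD mf f0.
apply: (eq_measurable_fun (fun x => f x `^ (-1))).
  by move=> x; rewrite inE => Dx; rewrite powR_inv1// ltW// f0.
exact: (@measurableT_comp _ _ _ _ _ _ (@powR R ^~ (-1))).
Qed.

End Measurability.

(** The kernel without its factor [h1], so that [h1] can be exchanged for a function equal to it
    almost everywhere. *)
Definition kernel_weight {R : realType} (a : R) (f1 f2 f3 : R -> R) (eps T : R)
    (s : R -> R) (t : R) : R :=
  if t < T then omega f2 a t%:E / (eps + omega f3 a t%:E ^+ 2)
  else (omega f1 (s t) t%:E)^-1.

(** * Pointwise bounds for the kernel and its integral over one step of the algorithm *)

Section Kernel.
Context {R : realType}.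
Notation mu := (@lebesgue_measure R).
Variables (a : R) (b : \bar R) (f1 f2 f3 : R -> R) (eps T : R) (s : R -> R).
Hypotheses (fi1 : mu.-integrable setT (EFin \o f1))
  (fi2 : mu.-integrable setT (EFin \o f2)) (fi3 : mu.-integrable setT (EFin \o f3)).
Hypotheses (f10 : forall x, 0 <= f1 x) (f20 : forall x, 0 <= f2 x)
  (f312 : forall x, f3 x ^+ 2 <= f1 x * f2 x).
Hypothesis tr_gt0 : forall u v, a <= u -> (u%:E < v)%E -> (v <= b)%E ->
  0 < trOm f1 f2 u v.
Hypothesis eps0 : 0 < eps.
Notation D := (detOm f1 f2 f3).
Hypotheses (aT : a < T) (Tb : (T%:E < b)%E) (DT : D a T%:E = eps).
Hypothesis sP : forall t, T <= t -> (t%:E < b)%E ->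
  [/\ a <= s t, s t <= t & D (s t) t%:E = eps].

Notation g := (kernel_weight a f1 f2 f3 eps T s).

Let le_D := le_detOm f1 f2 f3 fi1 fi2 fi3 f10 f20 f312.
Let ltl_D := lt_detOm_left f1 f2 f3 fi1 fi2 fi3 f10 f20 f312.

Let om1s_gt0 t : T <= t -> (t%:E < b)%E -> 0 < omega f1 (s t) t%:E.
Proof.
move=> Tt tb; have [_ _ Dt] := sP _ Tt tb.
rewrite lt_neqAle omega_ge0// andbT; apply/eqP => E.
have := detOm_le_mul f1 f2 f3 (s t) t%:E.
by rewrite -E mul0r Dt leNgt eps0.
Qed.

(** If [s t < u], strict monotonicity would give [eps = det Omega(s t, t) > det Omega(u, t) >= det
    Omega(u, w) = eps]. *)
Lemma start_ge u t : a <= u -> T <= t -> (t%:E < b)%E ->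
  (exists2 w, u <= w <= t & D u w%:E = eps) -> u <= s t.
Proof.
move=> au Tt tb [w /andP[uw wt] Dw]; have [as_ st Dt] := sP _ Tt tb.
rewrite leNgt; apply/negP => su.
have : eps <= D u t%:E by rewrite -Dw; apply: le_D; rewrite ?lee_fin.
rewrite leNgt => /negP; apply.
have [D0|D0] := ltP 0 (D u t%:E); last exact: le_lt_trans D0 eps0.
rewrite -Dt; apply: ltl_D => //; first exact: ltW.
  by rewrite lee_fin (le_trans uw).
apply: tr_gt0 => //; rewrite ?lte_fin//.
by apply: le_trans (ltW tb); rewrite lee_fin (le_trans uw).
Qed.

(** If [u < s t], then [det Omega(u, t) > eps], although [det Omega(u, t) <= det Omega(u, v) <=
    eps]. *)
Lemma start_le u v t : a <= u -> T <= t -> (t%:E < b)%E -> u <= t -> (t%:E <= v)%E ->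
  (v <= b)%E -> D u v <= eps -> s t <= u.
Proof.
move=> au Tt tb ut tv vb Dv; have [as_ st Dt] := sP _ Tt tb.
rewrite leNgt; apply/negP => us.
have : D u t%:E <= eps by apply: le_trans Dv; apply: le_D; rewrite ?lee_fin.
rewrite leNgt => /negP; apply.
rewrite -Dt; apply: ltl_D; rewrite ?lee_fin//.
- exact: ltW.
- apply: tr_gt0 => //; apply: le_trans (ltW tb); rewrite lee_fin//.
- by rewrite Dt.
Qed.

Lemma kernel_weight_ge0 t : Iv a b t -> 0 <= g t.
Proof.
move=> [at_ tb]; rewrite /kernel_weight; case: ltP => tT.
  by rewrite divr_ge0 ?omega_ge0// addr_ge0 ?sqr_ge0// ltW.
by rewrite invr_ge0 omega_ge0.
Qed.

(** From [T] on, this follows from [eps = det Omega(s t, t) <= omega1(s t, t) * omega2(a, b)]. *)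
Lemma kernel_weight_le t : Iv a b t -> g t <= omega f2 a b / eps.
Proof.
move=> [/= at_ tb]; rewrite /kernel_weight; case: ltP => tT.
  rewrite ler_pM ?omega_ge0 ?invr_ge0//.
  - by rewrite addr_ge0 ?sqr_ge0// ltW.
  - by apply: le_omega => //; [rewrite lee_fin ltW|exact: ltW].
  - by rewrite lef_pV2 ?posrE ?ltr_wpDr ?sqr_ge0// lerDl sqr_ge0.
have [as_ st Dt] := sP _ tT tb; have o1 := om1s_gt0 _ tT tb.
rewrite ler_pdivlMr// mulrC ler_pdivrMr//.
rewrite -Dt; apply: le_trans (detOm_le_mul _ _ _ _ _) _.
rewrite mulrC ler_wpM2r ?(ltW o1)//.
by apply: le_omega => //; exact: ltW.
Qed.

Lemma kernel_weight_measurable : measurable_fun (Iv a b) g.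
Proof.
have mom f : mu.-integrable setT (EFin \o f) ->
    measurable_fun setT (fun t : R => omega f a t%:E).
  by move=> fi; apply: continuous_measurable_fun; exact: omega_continuous.
have i1 : is_interval `]a, T[%classic by exact: interval_is_interval.
have i2 : is_interval [set t | T <= t /\ (t%:E < b)%E].
  move=> x y [/= Tx xb] [Ty yb] z /andP[xz zy].
  by split; [exact: le_trans xz|apply: le_lt_trans yb; rewrite lee_fin].
have m1 := is_interval_measurable i1; have m2 := is_interval_measurable i2.
have -> : Iv a b = `]a, T[%classic `|` [set t | T <= t /\ (t%:E < b)%E].
  apply/seteqP; split => t /=; rewrite in_itv/=.
    by move=> [-> tb]; case: (ltP t T) => tT; [left|right].
  move=> [/andP[at_ tT]|[Tt tb]]; split => //.
    by apply: lt_trans Tb; rewrite lte_fin.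
  exact: lt_le_trans Tt.
apply/measurable_funU => //; split.
  apply: (eq_measurable_fun (fun t => omega f2 a t%:E *
      (eps + omega f3 a t%:E ^+ 2)^-1)).
    by move=> t; rewrite inE/= in_itv/= /kernel_weight => /andP[_ ->].
  apply: measurable_funM; first exact: measurable_funTS (mom _ fi2).
  apply: measurable_funV_gt0 => //.
    apply: measurable_funD => //; apply: measurable_funX.
    exact: measurable_funTS (mom _ fi3).
  by move=> t _; rewrite ltr_wpDr ?sqr_ge0.
(* Writing [omega1(s t, t)] as a difference of primitives reduces the claim to measurability of
   [s]. *)
apply: (eq_measurable_fun (fun t => (omega f1 a t%:E - omega f1 a (s t)%:E)^-1)).
  move=> t; rewrite inE/= => -[Tt tb]; have [as_ st _] := sP _ Tt tb.
  rewrite /kernel_weight ltNge Tt/= (@omega_cat _ a (s t) t%:E)//.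
  by rewrite addrC addKr.
(* [s] is nondecreasing: apply [start_ge] at the later time to the interval from [s t] to [t], whose
   determinant is [eps]. *)
have ms : measurable_fun [set t | T <= t /\ (t%:E < b)%E] s.
  apply: nondecreasing_in_measurable => // t u [/= Tt tb] [Tu ub] tu.
  have [as_ st Dt] := sP _ Tt tb.
  by apply: start_ge => //; exists t => //; rewrite st.
apply: measurable_funV_gt0 => //.
  apply: measurable_funB; first exact: measurable_funTS (mom _ fi1).
  exact: (measurableT_comp (mom _ fi1) ms).
move=> t [Tt tb]; have [as_ st _] := sP _ Tt tb; have := om1s_gt0 _ Tt tb.
by rewrite (@omega_cat _ a (s t) t%:E)// addrC addKr.
Qed.

Lemma kernel_measurable : measurable_fun (Iv a b) (fun t => g t * f1 t).
Proof.
apply: measurable_funM; first exact: kernel_weight_measurable.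
by apply/measurable_EFinP; apply: (measurable_int mu); exact: integrableS fi1.
Qed.

(** With denominators cleared this reads [det Omega(a, t) <= eps], which holds before [T]. *)
Lemma kernel_initial t : a < t < T -> g t * omega f1 a t%:E <= 1.
Proof.
move=> /andP[at_ tT]; rewrite /kernel_weight tT mulrAC.
have e0 : 0 < eps + omega f3 a t%:E ^+ 2 by rewrite ltr_wpDr ?sqr_ge0.
rewrite ler_pdivrMr// mul1r mulrC.
have : D a t%:E <= eps by rewrite -DT; apply: le_D; rewrite // lee_fin ltW.
by rewrite /detOm lerBlDr.
Qed.

Lemma kernel_later u v t : a <= u -> T <= t -> (t%:E < b)%E -> u <= t ->
  (t%:E <= v)%E -> (v <= b)%E -> D u v <= eps -> g t * omega f1 u t%:E <= 1.
Proof.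
move=> au Tt tb ut tv vb Dv.
have su : s t <= u by exact: (start_le u v).
rewrite /kernel_weight ltNge Tt/= mulrC ler_pdivrMr ?om1s_gt0// mul1r.
by apply: le_omega; rewrite // lee_fin.
Qed.

(** The alternative on [u] covers the later steps and the first one; asking only [D u v <= eps]
    admits the final step, which ends at [b]. *)
Lemma integral_kernel_step_le u v n : a <= u -> (T <= u) || (u == a) ->
  (v <= b)%E -> D u v <= eps ->
  omega f2 a b / eps * omega f1 a b <= expR 1 ^+ n ->
  (\int[mu]_(t in Iv u v) (g t * f1 t)%:E <= (1 + n%:R * (expR 1 - 1))%:E)%E.
Proof.
move=> au Tu vb Dv Mn.
have sab : Iv u v `<=` Iv a b by exact: subset_Iv.
have Dab : eps <= D a b.
  by rewrite -DT; apply: le_D => //; [rewrite lee_fin ltW|exact: ltW].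
have o2 : 0 < omega f2 a b.
  rewrite lt_neqAle omega_ge0// andbT; apply/eqP => E.
  have := detOm_le_mul f1 f2 f3 a b.
  by rewrite -E mulr0 leNgt (lt_le_trans eps0).
have [vu|uv] := leP v u%:E.
  rewrite (_ : Iv u v = set0); first rewrite integral_set0 lee_fin.
    by rewrite addr_ge0// mulr_ge0// subr_ge0 ltW// expR_gt1.
  apply/seteqP; split => x //= [ux xv].
  by have := lt_le_trans xv vu; rewrite lte_fin => /(lt_trans ux); rewrite ltxx.
apply: (integral_kernel_le f1 _ u v (omega f2 a b / eps)) => //.
- by rewrite divr_gt0.
- by apply: measurable_funS kernel_measurable.
- by move=> t /sab abt; rewrite mulr_ge0 ?kernel_weight_ge0.
- by move=> t /sab abt; rewrite ler_wpM2r ?kernel_weight_le.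
- move=> t [/= ut tv]; rewrite mulrAC -[leRHS]mul1r ler_wpM2r//.
  have tb : (t%:E < b)%E by exact: lt_le_trans vb.
  have [tT|Tt] := ltP t T; last by apply: (kernel_later u v) => //; exact: ltW.
  case/orP: Tu => [Tu|/eqP uE].
    by have := lt_trans ut tT; rewrite ltNge Tu.
  by rewrite uE kernel_initial// -uE ut.
- apply: le_trans Mn; rewrite ler_wpM2l ?divr_ge0 ?(ltW o2) ?(ltW eps0)//.
  by apply: le_omega => //; exact: ltW.
Qed.

(** As [det Omega(p, u) = eps], [start_ge] gives [p <= s t] beyond [u], hence [omega1(s t, t) <=
    omega1(p, u) + omega1(u, t)]; [integral_kernel_ge_ln] applies with [A = omega1(p, u)]. *)
Lemma integral_kernel_step_ge p u v : a <= p -> p < u -> T <= u -> u <= v ->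
  (v%:E < b)%E -> D p u%:E = eps ->
  ((ln (1 + omega f1 u v%:E / omega f1 p u%:E))%:E <=
   \int[mu]_(t in Iv u v%:E) (g t * f1 t)%:E)%E.
Proof.
move=> ap pu Tu uv vb Dpu.
have sab : Iv u v%:E `<=` Iv a b.
  by apply: subset_Iv; [exact: le_trans (ltW pu)|exact: ltW].
apply: integral_kernel_ge_ln => //.
- rewrite lt_neqAle omega_ge0// andbT; apply/eqP => E.
  have := detOm_le_mul f1 f2 f3 p u%:E.
  by rewrite -E mul0r Dpu leNgt eps0.
- by apply: measurable_funS kernel_measurable.
- by move=> t /sab abt; rewrite mulr_ge0 ?kernel_weight_ge0.
- move=> t [/= ut tv].
  have tb : (t%:E < b)%E by exact: lt_trans vb.
  have Tt : T <= t by exact: le_trans (ltW ut).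
  have [as_ st Dt] := sP _ Tt tb.
  rewrite -omega_cat ?lee_fin ?(ltW ut) ?(ltW pu)// mulrAC.
  rewrite -[leLHS]mul1r ler_wpM2r//.
  rewrite /kernel_weight ltNge Tt/= mulrC ler_pdivlMr ?om1s_gt0// mul1r.
  apply: le_omega; rewrite ?lee_fin//.
  by apply: start_ge => //; exists u => //; rewrite (ltW ut) (ltW pu).
Qed.

End Kernel.

(** The source of the factor [2 e]: [1 + (2 l + 1) (e - 1) = e + 2 l (e - 1) <= 2 e (l + 1)]. *)
Lemma step_const_le (R : realFieldType) (e l N : R) : 0 <= l -> 1 < e ->
  N * (e - 1) <= (2 * l + 1) * (e - 1) -> 1 + N * (e - 1) <= 2 * e * (l + 1).
Proof.
move=> l0 e1; set X := N * (e - 1).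
have : 0 <= l * e by rewrite mulr_ge0// ltW// (lt_trans ltr01).
lra.
Qed.

(** * Summing the step estimates over the algorithm *)

Section Summation.
Context {R : realType}.
Notation mu := (@lebesgue_measure R).
Variables (a : R) (b : \bar R) (f1 f2 f3 : R -> R) (eps T : R) (s : R -> R).
Hypotheses (fi1 : mu.-integrable setT (EFin \o f1))
  (fi2 : mu.-integrable setT (EFin \o f2)) (fi3 : mu.-integrable setT (EFin \o f3)).
Hypotheses (f10 : forall x, 0 <= f1 x) (f20 : forall x, 0 <= f2 x)
  (f312 : forall x, f3 x ^+ 2 <= f1 x * f2 x).
Hypothesis tr_gt0 : forall u v, a <= u -> (u%:E < v)%E -> (v <= b)%E ->
  0 < trOm f1 f2 u v.
Hypothesis eps0 : 0 < eps.
Notation D := (detOm f1 f2 f3).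
Hypotheses (aT : a < T) (Tb : (T%:E < b)%E) (DT : D a T%:E = eps).
Hypothesis sP : forall t, T <= t -> (t%:E < b)%E ->
  [/\ a <= s t, s t <= t & D (s t) t%:E = eps].
Variables (k : nat) (sigma : nat -> R).
Hypotheses (k0 : (0 < k)%N) (sig0 : sigma 0 = a).
Hypothesis sigP : forall j, (j.+1 < k)%N -> [/\ sigma j < sigma j.+1,
  ((sigma j.+1)%:E < b)%E & D (sigma j) (sigma j.+1)%:E = eps].
Hypothesis sigk : D (sigma k.-1) b <= eps.

Notation K := (fun t => kernel_weight a f1 f2 f3 eps T s t * f1 t).
Notation L := (ln (trOm f1 f2 a b / (2 * Num.sqrt eps))).

Let le_D := le_detOm f1 f2 f3 fi1 fi2 fi3 f10 f20 f312.
Let ltr_D := lt_detOm_right f1 f2 f3 fi1 fi2 fi3 f10 f20 f312.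

Let ab : (a%:E < b)%E.
Proof. by apply: lt_trans Tb; rewrite lte_fin. Qed.

Let sig_bnd j : (j < k)%N -> a <= sigma j /\ ((sigma j)%:E < b)%E.
Proof.
elim: j => [|j IH] jk; first by rewrite sig0.
have [aj _] := IH (ltnW jk); have [jj jb _] := sigP _ jk.
by split => //; exact: le_trans (ltW jj).
Qed.

Let Dab : eps < D a b.
Proof.
rewrite -DT; apply: ltr_D; rewrite ?DT//; [exact: ltW|exact: ltW|].
by apply: tr_gt0 => //; exact: ltW.
Qed.

Let k1 : (1 < k)%N.
Proof.
by case: k k0 sigk => [|[|]]//= _; rewrite sig0 leNgt Dab.
Qed.

(** Both points solve [det Omega(a, .) = eps]. Hence every step but the first lies beyond [T], where
    the second branch of the kernel applies. *)
Let sig1 : sigma 1 = T.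
Proof.
have [a1 b1 D1] := sigP _ k1; rewrite sig0 in a1 D1.
apply/eqP; rewrite eq_le !leNgt; apply/andP; split; apply/negP => lt.
- have : D a T%:E < D a (sigma 1)%:E.
    apply: ltr_D; rewrite ?DT//; [exact: ltW|by rewrite lee_fin ltW|].
    by apply: tr_gt0; [exact: ltW|rewrite lte_fin|exact: ltW].
  by rewrite DT D1 ltxx.
- have : D a (sigma 1)%:E < D a T%:E.
    apply: ltr_D; rewrite ?D1//; [exact: ltW|by rewrite lee_fin ltW|].
    by apply: tr_gt0; [exact: ltW|rewrite lte_fin|exact: ltW].
  by rewrite DT D1 ltxx.
Qed.

Let T_le_sig j : (0 < j < k)%N -> T <= sigma j.
Proof.
elim: j => // -[|j] IH /andP[_ jk]; first by rewrite sig1.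
have [jj _ _] := sigP _ jk.
apply: le_trans (ltW jj); apply: IH; exact: ltnW jk.
Qed.

Let om1_gt0 u v : D u v = eps -> 0 < omega f1 u v.
Proof.
move=> Duv; rewrite lt_neqAle omega_ge0// andbT; apply/eqP => E.
by have := detOm_le_mul f1 f2 f3 u v; rewrite -E mul0r Duv leNgt eps0.
Qed.

Let om12_ge_eps : eps <= omega f1 a b * omega f2 a b.
Proof. by rewrite (le_trans (ltW Dab))// detOm_le_mul. Qed.

Let tau_gt0 : 0 < trOm f1 f2 a b.
Proof. by apply: tr_gt0. Qed.

(* AM-GM: [4 * om1 * om2 <= (om1 + om2)^2]. *)
Let ratio_le : omega f2 a b / eps * omega f1 a b <= expR (2 * L).
Proof.
have se : 0 < Num.sqrt eps by rewrite sqrtr_gt0.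
rewrite expRM_natl lnK ?posrE ?divr_gt0 ?mulr_gt0//.
rewrite expr_div_n exprMn sqr_sqrtr ?(ltW eps0)//.
have -> : omega f2 a b / eps * omega f1 a b =
  4 * (omega f1 a b * omega f2 a b) / (2 ^+ 2 * eps) by field; rewrite gt_eqF.
rewrite ler_pM2r ?invr_gt0 ?mulr_gt0 ?exprn_gt0// /trOm.
by have := sqr_ge0 (omega f1 a b - omega f2 a b); lra.
Qed.

Let L_ge0 : 0 <= L.
Proof.
have : 1 <= expR (2 * L).
  apply: le_trans ratio_le; rewrite mulrAC ler_pdivlMr// mul1r mulrC.
  exact: om12_ge_eps.
by rewrite -expR0 ler_expR pmulr_rge0.
Qed.

Let mK : measurable_fun (Iv a b) K.
Proof. exact: kernel_measurable. Qed.

Let K0 t : Iv a b t -> 0 <= K t.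
Proof. by move=> abt; rewrite mulr_ge0// (kernel_weight_ge0 a b). Qed.

Let K_cat u w v : a <= u -> u <= w -> (w%:E <= v)%E -> (v <= b)%E ->
  (\int[mu]_(t in Iv u v) (K t)%:E = \int[mu]_(t in Iv u w%:E) (K t)%:E +
   \int[mu]_(t in Iv w v) (K t)%:E)%E.
Proof.
move=> au uw wv vb; have sab : Iv u v `<=` Iv a b by exact: subset_Iv.
apply: ge0_integral_Iv_cat => //.
- by apply/measurable_EFinP; apply: measurable_funS mK.
- by move=> x /sab /K0; rewrite lee_fin.
Qed.

Lemma integral_kernel_upper :
  (\int[mu]_(t in Iv a b) (K t)%:E <= (2 * expR 1 * k%:R * (L + 1))%:E)%E.
Proof.
(* This [n] lies between [2 L] and [2 L + 1]: the lower bound makes [n] cuts sufficient on each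
   step, the upper one controls the constant. *)
pose n := (Num.truncn (2 * L)).+1; pose C : R := 1 + n%:R * (expR 1 - 1).
have nL : 2 * L <= n%:R by apply: ltW; exact: truncnS_gt.
have Ln : n%:R <= 2 * L + 1.
  by rewrite /n -natr1 lerD2r truncn_le// mulr_ge0.
have Mn : omega f2 a b / eps * omega f1 a b <= expR 1 ^+ n.
  by apply: le_trans ratio_le _; rewrite -expRM_natl mulr1 ler_expR.
have step j v : (j < k)%N -> (v <= b)%E -> D (sigma j) v <= eps ->
    (\int[mu]_(t in Iv (sigma j) v) (K t)%:E <= C%:E)%E.
  move=> jk vb Dv; have [aj _] := sig_bnd _ jk.
  apply: (integral_kernel_step_le a b) => //.
  by case: j jk {aj Dv} => [|j] jk; rewrite ?sig0 ?eqxx ?orbT// T_le_sig.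
(* Steps are split off from the left; after [k - 1] of them the final step up to [b] remains. *)
have upto m : (m < k)%N -> (\int[mu]_(t in Iv a b) (K t)%:E <=
    (m%:R * C)%:E + \int[mu]_(t in Iv (sigma m) b) (K t)%:E)%E.
  elim: m => [|m IH] mk; first by rewrite mul0r add0e sig0.
  apply: le_trans (IH (ltnW mk)) _.
  have [am _] := sig_bnd _ (ltnW mk); have [mm mb Dm] := sigP _ mk.
  rewrite (K_cat (sigma m) (sigma m.+1) b) ?(ltW mm) ?(ltW mb)//.
  rewrite addeA leeD2r// -natr1 mulrDl mul1r EFinD leeD2l//.
  by apply: step; rewrite ?(ltW mb) ?Dm// ltnW.
apply: (@le_trans _ _ (k%:R * C)%:E).
  have k1k : (k.-1 < k)%N by rewrite ltn_predL.
  apply: le_trans (upto _ k1k) _.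
  rewrite -[in X in (_ <= X)%E](prednK k0) -natr1 mulrDl mul1r EFinD leeD2l//.
  exact: step.
rewrite lee_fin -mulrA mulrCA ler_wpM2l//.
have e1 : 1 < expR 1 :> R by rewrite expR_gt1.
have := @ler_wpM2r _ (expR 1 - 1) _ _ _ Ln; rewrite subr_ge0 => /(_ (ltW e1)) nC.
exact: step_const_le.
Qed.

Lemma integral_kernel_lower :
  ((k%:R * ln 2 - ln (2 * trOm f1 f2 a b / Num.sqrt eps))%:E <=
   \int[mu]_(t in Iv a b) (K t)%:E)%E.
Proof.
pose x j := omega f1 (sigma j) (sigma j.+1)%:E.
have x0 j : (j.+1 < k)%N -> 0 < x j by move=> /sigP[_ _]; exact: om1_gt0.
(* The first step is only bounded below by 0; the [m] steps after it give the terms [ln 2] and the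
   telescoping differences. *)
have upto m : (m.+1 < k)%N -> ((m%:R * ln 2 + (ln (x m) - ln (x 0)) / 2)%:E <=
    \int[mu]_(t in Iv a (sigma m.+1)%:E) (K t)%:E)%E.
  elim: m => [|m IH] mk.
    rewrite mul0r subrr mul0r addr0; apply: integral_ge0 => t.
    by have [_ /ltW b1] := sig_bnd _ mk => /(subset_Iv _ _ _ _ (lexx a) b1) /K0.
  have mk' := ltnW mk.
  have [mm mb Dm] := sigP _ mk'; have [mm1 mb1 _] := sigP _ mk.
  have [am _] := sig_bnd _ (ltnW mk').
  rewrite (K_cat a (sigma m.+1)) ?lee_fin ?(ltW mm1) ?(ltW mb1)//; last first.
    exact: le_trans (ltW mm).
  have -> : m.+1%:R * ln 2 + (ln (x m.+1) - ln (x 0)) / 2 =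
      (m%:R * ln 2 + (ln (x m) - ln (x 0)) / 2) + (ln 2 + (ln (x m.+1) - ln (x m)) / 2).
    by rewrite -natr1; lra.
  rewrite EFinD; apply: leeD; first exact: IH.
  apply: (@le_trans _ _ (ln (1 + x m.+1 / x m))%:E); last first.
    by apply: (integral_kernel_step_ge a b) => //; [exact: T_le_sig|exact: ltW].
  rewrite lee_fin.
  have xm := x0 _ mk'; have xm1 := x0 _ mk.
  rewrite -ln_div ?posrE//; set z := x m.+1 / x m.
  have z0 : 0 < z by rewrite divr_gt0.
  clearbody z.
  (* AM-GM: [4 * z <= (1 + z)^2]. *)
  have : ln (2 ^+ 2 * z) <= ln ((1 + z) ^+ 2).
    rewrite ler_ln ?posrE ?mulr_gt0 ?exprn_gt0 ?addr_gt0//.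
    by have := sqr_ge0 (1 - z); lra.
  rewrite lnM ?posrE ?exprn_gt0// !lnXn ?addr_gt0//.
  lra.
(* Discarding the first step and the last one, which ends at [b], costs [2 * ln 2]; this turns
   [tr / (2 sqrt eps)] into [2 tr / sqrt eps] in the error term. *)
have [m Ek] : exists m, k = m.+2 by case: k k1 => [|[|m]]//; exists m.
have mk : (m.+1 < k)%N by rewrite Ek.
have [mm mb Dm] := sigP _ mk; have [am1 _] := sig_bnd _ mk.
have [am _] := sig_bnd _ (ltnW mk).
apply: (@le_trans _ _ (\int[mu]_(t in Iv a (sigma m.+1)%:E) (K t)%:E)%E); last first.
  apply: ge0_subset_integral => //.
  - exact/measurable_EFinP.
  - by apply: subset_Iv => //; exact: ltW.
apply: le_trans (upto _ mk); rewrite lee_fin Ek.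
have xm := x0 _ mk; have x00 := x0 _ k1.
(* Here [x 0 <= omega1(a, b)] and [x m >= eps / omega2(a, b)]; [ratio_le] bounds the quotient. *)
have H : ln (x 0) - ln (x m) <= 2 * L.
  rewrite -ln_div ?posrE// -[leRHS]expRK ler_ln ?posrE ?divr_gt0 ?expR_gt0//.
  apply: le_trans ratio_le; rewrite ler_pdivrMr//.
  have H1 : eps <= x m * omega f2 a b.
    rewrite -Dm; apply: le_trans (detOm_le_mul _ _ _ _ _) _.
    rewrite ler_wpM2l ?(ltW xm)//.
    by apply: le_omega => //; [rewrite lee_fin ltW|exact: ltW].
  have H0 : x 0 <= omega f1 a b.
    have [a1 b1 _] := sigP _ k1; rewrite /x.
    apply: le_omega => //; [by rewrite sig0|by rewrite lee_fin ltW|exact: ltW].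
  have -> : omega f2 a b / eps * omega f1 a b * x m =
    omega f1 a b * (x m * omega f2 a b / eps) by field; rewrite gt_eqF.
  by apply: le_trans H0 _; rewrite ler_peMr ?omega_ge0// ler_pdivlMr// mul1r.
have se : 0 < Num.sqrt eps by rewrite sqrtr_gt0.
have -> : ln (2 * trOm f1 f2 a b / Num.sqrt eps) = L + 2 * ln 2.
  have -> : 2 * ln 2 = ln (2 ^+ 2) :> R by rewrite lnXn// mulr_natl.
  rewrite -lnM ?posrE ?divr_gt0 ?mulr_gt0 ?exprn_gt0//.
  by congr ln; field; rewrite gt_eqF.
rewrite -[m.+2%:R]natr1 -[m.+1%:R]natr1; lra.
Qed.

End Summation.

(** * From almost everywhere to everywhere positive semidefinite Hamiltonians *)

Section Regularization.
Context {R : realType}.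
Notation mu := (@lebesgue_measure R).
Variables (a : R) (b : \bar R).

(** Local integrability gives measurability on [(a, c)] for [c < b] only; countably many of these
    exhaust [(a, b)]. *)
Lemma measurable_fun_Iv_exhaust (h : R -> R) : (a%:E < b)%E ->
  (forall c : R, (c%:E < b)%E -> measurable_fun (Iv a c%:E) h) ->
  measurable_fun (Iv a b) h.
Proof.
case: b => [b'| |//] ab mh; last first.
  rewrite -bigcup_Iv_nat; apply/measurable_fun_bigcup => // n.
  by apply: mh; rewrite ltry.
have -> : Iv a b'%:E = \bigcup_n Iv a (b' - n.+1%:R^-1)%:E.
  apply/seteqP; split => x /=.
    move=> [ax]; rewrite lte_fin => xb.
    exists (Num.truncn (b' - x)^-1) => //; split => //=.
    rewrite lte_fin ltrBrDr -ltrBrDl -[ltRHS]invrK.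
    by rewrite ltf_pV2 ?posrE ?invr_gt0 ?subr_gt0//; exact: truncnS_gt.
  move=> [n _ [ax]]; rewrite lte_fin => xb; split => //; rewrite lte_fin.
  by apply: lt_le_trans xb _; rewrite gerDl oppr_le0.
apply/measurable_fun_bigcup => // n; apply: mh.
by rewrite lte_fin gtrDl oppr_lt0 invr_gt0.
Qed.

Lemma Iv_not_null u v : (u%:E < v)%E -> mu (Iv u v) != 0%E.
Proof.
move=> uv.
have [w uw wv] : exists2 w, u < w & (w%:E <= v)%E.
  case: v uv => [v| |//]; first by rewrite lte_fin => uv; exists v.
  by move=> _; exists (u + 1); [rewrite ltrDl|rewrite leey].
apply/eqP => E; have : (mu `]u, w[%classic <= mu (Iv u v))%E.
  apply: le_measure; rewrite ?inE// => x; rewrite /= in_itv/= => /andP[ux xw].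
  by split => //; apply: lt_le_trans wv; rewrite lte_fin.
rewrite E lebesgue_measure_itv/= lte_fin uw -EFinB lee_fin subr_le0.
by rewrite leNgt uw.
Qed.

Variables (h1 h2 h3 : R -> R).
Hypotheses (mh1 : measurable_fun (Iv a b) h1) (mh2 : measurable_fun (Iv a b) h2)
  (mh3 : measurable_fun (Iv a b) h3).
Variable N : set R.
Hypotheses (mN : measurable N) (N0 : mu N = 0%E).
Hypothesis psdN : forall x, Iv a b x -> ~ N x ->
  [/\ 0 <= h1 x, 0 <= h2 x & h3 x ^+ 2 <= h1 x * h2 x].

(* Zeroing [H] on the null set [N] where it may fail to be positive semidefinite
   makes the a.e. hypotheses hold everywhere without changing any integral. *)
Definition regularized (h : R -> R) : R -> R := h \_ (Iv a b `\` N).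

Lemma regularizedE h x : Iv a b x -> ~ N x -> regularized h x = h x.
Proof. by move=> abx Nx; rewrite /regularized patchE ifT// inE. Qed.

Lemma regularized_psd x : [/\ 0 <= regularized h1 x, 0 <= regularized h2 x &
  regularized h3 x ^+ 2 <= regularized h1 x * regularized h2 x].
Proof.
rewrite /regularized !patchE; case: ifPn; first by rewrite inE => -[]; exact: psdN.
by rewrite expr0n mul0r.
Qed.

Lemma regularized_measurable h : measurable_fun (Iv a b) h ->
  measurable_fun setT (regularized h).
Proof.
move=> mh; apply/(measurable_restrictT h); first exact: measurableD.
by apply: measurable_funS mh => //; exact: subDsetl.
Qed.

(** Stated for general integrands so as to serve the entries of [H], the trace and the kernel
    alike. *)
Lemma integral_regularized u v (k k' : R -> R) : a <= u -> (v <= b)%E ->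
  measurable_fun (Iv a b) k -> measurable_fun (Iv a b) k' ->
  (forall x, Iv a b x -> ~ N x -> k x = k' x) ->
  (\int[mu]_(x in Iv u v) (k x)%:E = \int[mu]_(x in Iv u v) (k' x)%:E)%E.
Proof.
move=> au vb mk mk' kk'; have sab : Iv u v `<=` Iv a b by exact: subset_Iv.
apply: ae_eq_integral => //.
- by apply/measurable_EFinP; exact: measurable_funS mk.
- by apply/measurable_EFinP; exact: measurable_funS mk'.
- exists N; split => // x /= H; apply: contrapT => Nx; apply: H => /sab abx.
  by rewrite kk'.
Qed.

Lemma omega_regularized h u v : measurable_fun (Iv a b) h -> a <= u ->
  (v <= b)%E -> omega (regularized h) u v = omega h u v.
Proof.
move=> mh au vb; congr fine; apply: integral_regularized => //.
  by apply: measurable_funTS; exact: regularized_measurable.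
exact: regularizedE.
Qed.

Hypothesis lc : limit_circle a b h1 h2.

(** The limit circle condition makes the trace integrable, and the trace dominates every entry:
    [h3^2 <= h1 h2 <= (h1 + h2)^2]. *)
Lemma regularized_integrable : [/\ mu.-integrable setT (EFin \o regularized h1),
  mu.-integrable setT (EFin \o regularized h2) &
  mu.-integrable setT (EFin \o regularized h3)].
Proof.
(* The regularized functions vanish off [(a, b)], so they meet the whole-line integrability
   hypotheses of the earlier lemmas. *)
have toT h : mu.-integrable (Iv a b) (EFin \o regularized h) ->
    mu.-integrable setT (EFin \o regularized h).
  move=> ih; have : mu.-integrable setT ((EFin \o regularized h) \_ (Iv a b)).
    by apply/(integrable_mkcond _ _).1.
  apply: eq_integrable => // x _.
  rewrite patchE; case: ifPn => //; rewrite notin_setE => nx /=.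
  by rewrite /regularized patchE ifF//; apply/negbTE; rewrite notin_setE => -[].
have mr h : measurable_fun (Iv a b) h -> measurable_fun (Iv a b) (regularized h).
  by move=> mh; apply: measurable_funTS; exact: regularized_measurable.
have itr : mu.-integrable (Iv a b)
    (EFin \o (fun x => regularized h1 x + regularized h2 x)).
  apply/integrableP; split.
    by apply/measurable_EFinP/measurable_funD; exact: mr.
  apply: le_lt_trans lc; rewrite le_eqVlt; apply/orP; left; apply/eqP.
  under eq_integral => x _.
    have [r1 r2 _] := regularized_psd x.
    rewrite /= ger0_norm ?addr_ge0//; over.
  apply: integral_regularized => //.
  - by apply: measurable_funD; exact: mr.
  - exact: measurable_funD.
  - by move=> x abx Nx; rewrite !regularizedE.
have dom h : measurable_fun (Iv a b) h ->
    (forall x, `|regularized h x| <= regularized h1 x + regularized h2 x) ->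
    mu.-integrable (Iv a b) (EFin \o regularized h).
  move=> mh hle; apply: le_integrable itr => //; first by apply/measurable_EFinP; exact: mr.
  by move=> x _ /=; rewrite lee_fin; apply: le_trans (hle x) _; exact: ler_norm.
split; apply: toT; apply: dom => // x; have [r1 r2 r3] := regularized_psd x.
- by rewrite ger0_norm// lerDl.
- by rewrite ger0_norm// lerDr.
- rewrite -ler_sqr ?nnegrE ?addr_ge0// -normrX ger0_norm ?sqr_ge0//.
  apply: le_trans r3 _; nra.
Qed.

Hypothesis nz : mu.-negligible [set x | Iv a b x /\ h1 x = 0 /\ h2 x = 0 /\ h3 x = 0].

(** A zero integral of the trace would force [H = 0] almost everywhere on [(u, v)], a set of
    positive measure. *)
Lemma trOm_regularized_gt0 u v : a <= u -> (u%:E < v)%E -> (v <= b)%E ->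
  0 < trOm (regularized h1) (regularized h2) u v.
Proof.
move=> au uv vb; have [i1 i2 _] := regularized_integrable.
have r0 x : 0 <= regularized h1 x + regularized h2 x.
  by have [r1 r2 _] := regularized_psd x; exact: addr_ge0.
rewrite /trOm -omegaD// lt_neqAle omega_ge0// andbT; apply/eqP => E.
have itr : mu.-integrable setT (EFin \o (fun x => regularized h1 x + regularized h2 x)).
  by apply: eq_integrable (integrableD measurableT i1 i2).
have [N' [mN' N'0 sN']] : ae_eq mu (Iv u v)
    (EFin \o (fun x => regularized h1 x + regularized h2 x)) (cst 0%E).
  apply/ae_eq_integral_abs => //.
    by apply: (measurable_int mu); exact: integrableS itr.
  transitivity (\int[mu]_(x in Iv u v) (regularized h1 x + regularized h2 x)%:E)%E.
    by apply: eq_integral => x _ /=; rewrite ger0_norm.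
  by rewrite -EFin_omega// -E.
have sab : Iv u v `<=` Iv a b by exact: subset_Iv.
have : mu.-negligible (Iv u v).
  have nN : mu.-negligible N by apply/negligibleP.
  have nN' : mu.-negligible N' by apply/negligibleP.
  apply: negligibleS (negligibleU (negligibleU nN nN') nz).
  move=> x uvx; have abx := sab _ uvx.
  have [Nx|Nx] := pselect (N x); first by left; left.
  have [N'x|N'x] := pselect (N' x); first by left; right.
  right; split => //.
  have : regularized h1 x + regularized h2 x = 0.
    by apply: contrapT => H; apply: N'x; apply: sN' => /= /(_ uvx) [].
  rewrite !regularizedE// => /eqP; have [p1 p2 p3] := psdN _ abx Nx.
  rewrite paddr_eq0// => /andP[/eqP h10 /eqP h20]; split => //; split => //.
  by apply/eqP; rewrite -sqrf_eq0 eq_le sqr_ge0 andbT (le_trans p3)// h10 mul0r.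
move/negligibleP => /(_ (measurable_Iv u v)) /eqP; apply/negP.
exact: Iv_not_null.
Qed.

End Regularization.

(** * Transfer of the estimates from the regularized Hamiltonian to the given one *)

Theorem theorem5p3 (R : realType) (a : R) (b : \bar R) (h1 h2 h3 : R -> R)
  (c : R) (tt : R -> R) (ss : R -> R -> R) :
  hamiltonian a b h1 h2 h3 ->
  limit_circle a b h1 h2 ->
  definite a b h1 h2 h3 ->
  0 < c ->
  let r0 := Num.sqrt (c / detOm h1 h2 h3 a b) in
  compatible_pair a b h1 h2 h3 r0 c tt ss ->
  forall (r : R) (k : nat), r0 < r ->
  kappa_is a b h1 h2 h3 c r k ->
  let I := (\int[@lebesgue_measure R]_(t in Iv a b)
              (kernelH a h1 h2 h3 c tt ss r t)%:E)%E in
  let trO := trOm h1 h2 a b in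
  ((k%:R * ln 2 - (ln r + ln (2 * trO / Num.sqrt c)))%:E <= I)%E /\
  (I <= (2 * expR 1 * k%:R * (ln r + ln (trO / (2 * Num.sqrt c)) + 1))%:E)%E.
Proof.
move=> [ab loc psd nz] lc _ c0 r0 [cpt cps] r k r0r [k0 [sigma [sig0 sigP sigk]]] I trO.
have mh h : (forall c' : R, (c'%:E < b)%E ->
    (@lebesgue_measure R).-integrable (Iv a c'%:E) (EFin \o h)) ->
    measurable_fun (Iv a b) h.
  move=> ih; apply: measurable_fun_Iv_exhaust => // c' /ih ic.
  by apply/measurable_EFinP; exact: measurable_int ic.
have mh1 : measurable_fun (Iv a b) h1 by apply: mh => c' /loc[].
have mh2 : measurable_fun (Iv a b) h2 by apply: mh => c' /loc[].
have mh3 : measurable_fun (Iv a b) h3 by apply: mh => c' /loc[].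
have [N [mN N0 sN]] := psd.
have psdN x : Iv a b x -> ~ N x ->
    [/\ 0 <= h1 x, 0 <= h2 x & h3 x ^+ 2 <= h1 x * h2 x].
  move=> abx Nx; apply: psd2_det; apply: contrapT => H; apply/Nx/sN.
  by split.
pose f1 := regularized a b N h1; pose f2 := regularized a b N h2.
pose f3 := regularized a b N h3.
have rpos : 0 < r by apply: le_lt_trans r0r; exact: sqrtr_ge0.
pose eps := c / r ^+ 2.
have eps0 : 0 < eps by rewrite divr_gt0// exprn_gt0.
have [fi1 fi2 fi3] := regularized_integrable _ _ _ _ _ mh1 mh2 mh3 _ mN N0 psdN lc.
have fpsd := regularized_psd _ _ _ _ _ _ psdN.
have f10 x : 0 <= f1 x by have [] := fpsd x.
have f20 x : 0 <= f2 x by have [] := fpsd x.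
have f312 x : f3 x ^+ 2 <= f1 x * f2 x by have [] := fpsd x.
have tr_gt0 := trOm_regularized_gt0 _ _ _ _ _ mh1 mh2 mh3 _ mN N0 psdN lc nz.
have om h u v : measurable_fun (Iv a b) h -> a <= u -> (v <= b)%E ->
    omega h u v = omega (regularized a b N h) u v.
  by move=> mh'' au vb; rewrite omega_regularized.
have det u v : a <= u -> (v <= b)%E ->
    detOm h1 h2 h3 u v = detOm f1 f2 f3 u v.
  by move=> au vb; rewrite /detOm (om h1)// (om h2)// (om h3).
have [aT Tb DT] := cpt r r0r.
have {}DT : detOm f1 f2 f3 a (tt r)%:E = eps by rewrite -det// ltW.
pose s t := ss t r.
have sP t : tt r <= t -> (t%:E < b)%E ->
    [/\ a <= s t, s t <= t & detOm f1 f2 f3 (s t) t%:E = eps].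
  by move=> Tt tb; have [p1 p2 p3] := cps r t r0r Tt tb; split; rewrite // -det// ltW.
have asig j : (j < k)%N -> a <= sigma j.
  elim: j => [|j IH] jk; first by rewrite sig0.
  by have [_ jj _ _] := sigP _ jk; apply: le_trans (ltW jj); apply: IH; exact: ltnW.
have sigP' j : (j.+1 < k)%N -> [/\ sigma j < sigma j.+1,
    ((sigma j.+1)%:E < b)%E & detOm f1 f2 f3 (sigma j) (sigma j.+1)%:E = eps].
  move=> jk; have [_ jj jb Dj] := sigP _ jk; split => //.
  by rewrite -det//; [apply: asig; exact: ltnW|exact: ltW].
have sigk' : detOm f1 f2 f3 (sigma k.-1) b <= eps.
  by rewrite -det//; apply: asig; rewrite ltn_predL.
have trE : trO = trOm f1 f2 a b by rewrite /trO /trOm (om h1)// (om h2).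
have tau0 : 0 < trO by rewrite trE; exact: tr_gt0.
pose g := kernel_weight a f1 f2 f3 eps (tt r) s.
(* The weight involves [H] only through [omega], which regularization preserves; the bare factor
   [h1] is exchanged later, under the integral. *)
have gh t : Iv a b t -> kernelH a h1 h2 h3 c tt ss r t = g t * h1 t.
  move=> [at_ tb]; rewrite /kernelH /g /kernel_weight.
  case: ltP => tT; first by rewrite (om h2) ?(om h3) ?(ltW tb)// mulrAC.
  have [as_ _ _] := sP _ tT tb.
  by rewrite (om h1) ?(ltW tb)// mulrC.
have mg : measurable_fun (Iv a b) g by apply: kernel_weight_measurable.
have -> : I = (\int[@lebesgue_measure R]_(t in Iv a b) (g t * f1 t)%:E)%E.
  transitivity (\int[@lebesgue_measure R]_(t in Iv a b) (g t * h1 t)%:E)%E.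
    by apply: eq_integral => t; rewrite inE => /gh ->.
  apply: (integral_regularized a b _ mN N0) => //.
  - exact: measurable_funM.
  - apply: measurable_funM => //; apply: measurable_funTS.
    exact: regularized_measurable.
  - by move=> t abt Nt; rewrite /f1 regularizedE.
(* Since [eps = c / r^2], trading [sqrt c] for [sqrt eps] absorbs [ln r] in both error terms. *)
have sqE : Num.sqrt eps = Num.sqrt c / r.
  by rewrite sqrtrM ?(ltW c0)// sqrtrV ?exprn_ge0 ?(ltW rpos)// sqrtr_sqr gtr0_norm.
have sc : 0 < Num.sqrt c by rewrite sqrtr_gt0.
have -> : ln r + ln (2 * trO / Num.sqrt c) = ln (2 * trO / Num.sqrt eps).
  rewrite -lnM ?posrE ?divr_gt0 ?mulr_gt0// sqE; congr ln.
  by field; rewrite !gt_eqF.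
have -> : ln r + ln (trO / (2 * Num.sqrt c)) = ln (trO / (2 * Num.sqrt eps)).
  rewrite -lnM ?posrE ?divr_gt0 ?mulr_gt0// sqE; congr ln.
  by field; rewrite !gt_eqF.
rewrite trE; split.
- exact: (integral_kernel_lower _ _ _ _ _ _ _ _ _ _ _ _ _ _ _ _ _ _ _ _ _ sigma).
- exact: (integral_kernel_upper _ _ _ _ _ _ _ _ _ _ _ _ _ _ _ _ _ _ _ _ _ sigma).
Qed.
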